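(* Let $\mathcal{L}^R$ be the free monoidal category with a family of right monoidal endofunctors $\{E^i\mid i\in\mathcal{I}\}$ generated by a set of generating objects. Then the functor $G$ from $\mathcal{L}^R$ to the category $\mathit{Fun}$ of functions between finite ordinals is faithful; this amounts to $\mathcal{L}^R$ being a preorder, i.e. any two arrows $f,g:A\to B$ of $\mathcal{L}^R$ with the same source and target are equal.
   Context: A monoidal category is a category with a bifunctor $\otimes$, a unit object $I$, and natural isomorphisms with components $a_{A,B,C}:(A\otimes B)\otimes C\to A\otimes(B\otimes C)$, $l_A:I\otimes A\to A$, $r_A:A\otimes I\to A$, satisfying Mac Lane's coherence equations (pentagon and triangle). A right monoidal endofunctor of a monoidal category is an endofunctor $E$ together with a natural transformation $\psi^R_{A,B}:A\otimes EB\to E(A\otimes B)$ such that (1) $Ea_{A,B,C}\circ\psi^R_{A\otimes B,C}=\psi^R_{A,B\otimes C}\circ(\mathbf{1}_A\otimes\psi^R_{B,C})\circ a_{A,B,EC}$; (2) $El_A\circ\psi^R_{I,A}=l_{EA}$. The category $\mathcal{L}^R$: fix two arbitrary sets, one of generating objects (propositional letters) and one of generating functors $\{E^i\mid i\in\mathcal{I}\}$. Objects are the formulae built from the letters and the constant $I$ with the binary connective $\otimes$ and the unary connectives $E^i$. Arrows are equivalence classes of arrow terms built from $\mathbf{1}_A$, $a_{A,B,C}$, $l_A$, $r_A$, the inverses of $a,l,r$, and $\psi^{R,i}_{A,B}$ (for each $i\in\mathcal{I}$) with the operations $\circ$, $\otimes$ and $E^i$, modulo the smallest congruence for which the equations of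 monoidal categories hold and each $(E^i,\psi^{R,i})$ is a right monoidal endofunctor. Superscripts $i$ are omitted below. The functor $G$: $\mathit{Fun}$ has as objects the finite ordinals $n=\{0,\dots,n-1\}$ and as arrows all functions. $GA$ is the number of occurrences of the generating functors $E^i$ (for all $i$ together) in $A$, numbered $0,1,\dots$ from left to right. $G$ of $\mathbf{1}$, $a$, $l$, $r$ (and inverses) is an identity function; $G\psi^R_{A,B}:GA+1+GB\to 1+GA+GB$ maps $k\mapsto 1+k$ for $k<GA$, $GA\mapsto 0$, and $GA+1+k\mapsto GA+1+k$ for $k<GB$; $G(f\otimes g)$ is $Gf$ and $Gg$ placed side by side (disjoint sum); $GEf$ maps $0\mapsto 0$ and $1+k\mapsto 1+(Gf)(k)$; $G(g\circ f)=Gg\circ Gf$. *)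

(* Defs.v *)
From HB Require Import structures.
From mathcomp Require Import all_boot.
From mathcomp Require Import boolp.

Set Implicit Arguments.
Unset Strict Implicit.
Unset Printing Implicit Defensive.

Local Open Scope quotient_scope.

Record category : Type := Category {
  obj : Type;
  hom : obj -> obj -> Type;
  idc : forall A, hom A A;
  compc : forall A B C, hom B C -> hom A B -> hom A C;
  comp_idl : forall A B (f : hom A B), compc (idc B) f = f;
  comp_idr : forall A B (f : hom A B), compc f (idc A) = f;
  comp_assoc : forall A B C D (h : hom C D) (g : hom B C) (f : hom A B),
    compc h (compc g f) = compc (compc h g) f
}.

Record functor (C D : category) : Type := Functor {
  fobj : obj C -> obj D;
  fmap : forall A B : obj C, hom A B -> hom (fobj A) (fobj B);
  fmap_id : forall A : obj C, fmap (idc A) = idc (fobj A);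
  fmap_comp : forall (A B E : obj C) (g : hom B E) (f : hom A B),
    fmap (compc g f) = compc (fmap g) (fmap f)
}.

Definition faithful (C D : category) (F : functor C D) : Prop :=
  forall (A B : obj C) (f g : hom A B), fmap F f = fmap F g -> f = g.

Definition preorder_category (C : category) : Prop :=
  forall (A B : obj C) (f g : hom A B), f = g.

(* [{ffun 'I_m -> 'I_n}] rather than ['I_m -> 'I_n], so that equality of arrows
   is pointwise equality of functions. *)
Section FunCategory.

Definition fun_id n : {ffun 'I_n -> 'I_n} := [ffun i => i].

Definition fun_comp m n p (g : {ffun 'I_n -> 'I_p}) (f : {ffun 'I_m -> 'I_n}) :
  {ffun 'I_m -> 'I_p} := [ffun i => g (f i)].

Lemma fun_comp_idl m n (f : {ffun 'I_m -> 'I_n}) : fun_comp (fun_id n) f = f.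
Proof. by apply/ffunP => i; rewrite !ffunE. Qed.

Lemma fun_comp_idr m n (f : {ffun 'I_m -> 'I_n}) : fun_comp f (fun_id m) = f.
Proof. by apply/ffunP => i; rewrite !ffunE. Qed.

Lemma fun_comp_assoc m n p q (h : {ffun 'I_p -> 'I_q})
    (g : {ffun 'I_n -> 'I_p}) (f : {ffun 'I_m -> 'I_n}) :
  fun_comp h (fun_comp g f) = fun_comp (fun_comp h g) f.
Proof. by apply/ffunP => i; rewrite !ffunE. Qed.

Definition Fun : category :=
  Category fun_comp_idl fun_comp_idr fun_comp_assoc.

(* The identity function, between ordinals that are equal but not
   syntactically so. *)
Definition fun_cast m n (e : m = n) : {ffun 'I_m -> 'I_n} :=
  [ffun i => cast_ord e i].

Definition fun_sum m n p q (f : {ffun 'I_m -> 'I_n}) (g : {ffun 'I_p -> 'I_q}) :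
  {ffun 'I_(m + p) -> 'I_(n + q)} :=
  [ffun i => match split i with
             | inl k => lshift q (f k)
             | inr k => rshift n (g k)
             end].

Definition fun_succ m n (f : {ffun 'I_m -> 'I_n}) :
  {ffun 'I_m.+1 -> 'I_n.+1} :=
  [ffun i => if unlift ord0 i is Some k then lift ord0 (f k) else ord0].

(* k |-> 1 + k for k < m,  m |-> 0,  m + 1 + k |-> m + 1 + k for k < n;
   [lift ord0] is the successor function. *)
Definition fun_psi m n : {ffun 'I_(m + n.+1) -> 'I_(m + n).+1} :=
  [ffun i => match split i with
             | inl k => lift ord0 (lshift n k)
             | inr k => if unlift ord0 k is Some j
                        then lift ord0 (rshift m j) else ord0
             end].

End FunCategory.

Section LR.

(* P: generating objects (propositional letters); J: indices of the generating functors. *)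
Variables P J : Type.

Inductive form : Type :=
| Letter of P
| Unit
| Tensor of form & form
| EF of J & form.

Local Notation "A ⊠ B" := (Tensor A B) (at level 40, left associativity).
Local Notation I := Unit.

Inductive term : form -> form -> Type :=
| tid A : term A A
| ta A B C : term (A ⊠ B ⊠ C) (A ⊠ (B ⊠ C))
| tl A : term (I ⊠ A) A
| tr A : term (A ⊠ I) A
| ta_inv A B C : term (A ⊠ (B ⊠ C)) (A ⊠ B ⊠ C)
| tl_inv A : term A (I ⊠ A)
| tr_inv A : term A (A ⊠ I)
| tpsi i A B : term (A ⊠ EF i B) (EF i (A ⊠ B))
| tcomp A B C : term B C -> term A B -> term A C
| tten A B C D : term A B -> term C D -> term (A ⊠ C) (B ⊠ D)
| tE i A B : term A B -> term (EF i A) (EF i B).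

Local Notation "g ∘ f" := (tcomp g f) (at level 40, left associativity).
Local Notation "f ⊗ g" := (tten f g) (at level 39, left associativity).
Local Reserved Notation "f ≈ g" (at level 70).
Local Notation "1_[ A ]" := (tid A).

Inductive eqv : forall A B : form, term A B -> term A B -> Prop :=
| eqv_refl A B (f : term A B) : f ≈ f
| eqv_sym A B (f g : term A B) : f ≈ g -> g ≈ f
| eqv_trans A B (f g h : term A B) : f ≈ g -> g ≈ h -> f ≈ h
| eqv_comp A B C (g g' : term B C) (f f' : term A B) :
    g ≈ g' -> f ≈ f' -> g ∘ f ≈ g' ∘ f'
| eqv_ten A B C D (f f' : term A B) (g g' : term C D) :
    f ≈ f' -> g ≈ g' -> f ⊗ g ≈ f' ⊗ g'
| eqv_E i A B (f f' : term A B) : f ≈ f' -> tE i f ≈ tE i f'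
| eqv_idl A B (f : term A B) : 1_[B] ∘ f ≈ f
| eqv_idr A B (f : term A B) : f ∘ 1_[A] ≈ f
| eqv_assoc A B C D (h : term C D) (g : term B C) (f : term A B) :
    h ∘ (g ∘ f) ≈ (h ∘ g) ∘ f
| eqv_ten_id A B : 1_[A] ⊗ 1_[B] ≈ 1_[A ⊠ B]
| eqv_ten_comp A B C A' B' C'
    (g : term B C) (f : term A B) (g' : term B' C') (f' : term A' B') :
    (g ∘ f) ⊗ (g' ∘ f') ≈ (g ⊗ g') ∘ (f ⊗ f')
| eqv_a_nat A B C A' B' C' (f : term A A') (g : term B B') (h : term C C') :
    ta A' B' C' ∘ (f ⊗ g ⊗ h) ≈ (f ⊗ (g ⊗ h)) ∘ ta A B C
| eqv_l_nat A B (f : term A B) : tl B ∘ (1_[I] ⊗ f) ≈ f ∘ tl A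
| eqv_r_nat A B (f : term A B) : tr B ∘ (f ⊗ 1_[I]) ≈ f ∘ tr A
| eqv_aK A B C : ta_inv A B C ∘ ta A B C ≈ 1_[A ⊠ B ⊠ C]
| eqv_aVK A B C : ta A B C ∘ ta_inv A B C ≈ 1_[A ⊠ (B ⊠ C)]
| eqv_lK A : tl_inv A ∘ tl A ≈ 1_[I ⊠ A]
| eqv_lVK A : tl A ∘ tl_inv A ≈ 1_[A]
| eqv_rK A : tr_inv A ∘ tr A ≈ 1_[A ⊠ I]
| eqv_rVK A : tr A ∘ tr_inv A ≈ 1_[A]
| eqv_pentagon A B C D :
    ta A B (C ⊠ D) ∘ ta (A ⊠ B) C D
    ≈ (1_[A] ⊗ ta B C D) ∘ ta A (B ⊠ C) D ∘ (ta A B C ⊗ 1_[D])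
| eqv_triangle A B : (1_[A] ⊗ tl B) ∘ ta A I B ≈ tr A ⊗ 1_[B]
| eqv_E_id i A : tE i 1_[A] ≈ 1_[EF i A]
| eqv_E_comp i A B C (g : term B C) (f : term A B) :
    tE i (g ∘ f) ≈ tE i g ∘ tE i f
| eqv_psi_nat i A B A' B' (f : term A A') (g : term B B') :
    tpsi i A' B' ∘ (f ⊗ tE i g) ≈ tE i (f ⊗ g) ∘ tpsi i A B
| eqv_psi_a i A B C :
    tE i (ta A B C) ∘ tpsi i (A ⊠ B) C
    ≈ tpsi i A (B ⊠ C) ∘ (1_[A] ⊗ tpsi i B C) ∘ ta A B (EF i C)
| eqv_psi_l i A : tE i (tl A) ∘ tpsi i I A ≈ tl (EF i A)
where "f ≈ g" := (eqv f g).

(* Arrow terms over arbitrary types have no computable choice structure; the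
   classical one lets the library quotient be used, so that equality of arrows
   is Leibniz equality and operations are defined on representatives. *)
HB.instance Definition _ A B := gen_eqMixin (term A B).
HB.instance Definition _ A B := gen_choiceMixin (term A B).

Section Arrows.
Variables A B : form.

Definition eqvb (f g : term A B) : bool := `[< f ≈ g >].

Lemma eqvb_refl : reflexive eqvb.
Proof. by move=> f; apply/asboolP/eqv_refl. Qed.

Lemma eqvb_sym : symmetric eqvb.
Proof.
by move=> f g; apply/asboolP/asboolP => H; apply: eqv_sym.
Qed.

Lemma eqvb_trans : transitive eqvb.
Proof.
move=> g f h /asboolP fg /asboolP gh; apply/asboolP.
exact: eqv_trans fg gh.
Qed.

Canonical eqv_rel := EquivRel eqvb eqvb_refl eqvb_sym eqvb_trans.

Definition arrow : Type := {eq_quot eqv_rel}.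
HB.instance Definition _ := EqQuotient.on arrow.

End Arrows.

Definition cls A B (f : term A B) : arrow A B := \pi_(arrow A B) f.
Definition rep A B (f : arrow A B) : term A B := repr f.

Lemma clsP A B (f g : term A B) : cls f = cls g <-> f ≈ g.
Proof.
split=> [/eqquotP/asboolP //|H].
by apply/eqquotP/asboolP.
Qed.

Lemma repK A B (f : arrow A B) : cls (rep f) = f.
Proof. exact: reprK. Qed.

Lemma rep_cls A B (f : term A B) : rep (cls f) ≈ f.
Proof. by apply/clsP; rewrite repK. Qed.

Definition arrow_id A : arrow A A := cls 1_[A].

Definition arrow_comp A B C (g : arrow B C) (f : arrow A B) : arrow A C :=
  cls (rep g ∘ rep f).

Lemma cls_comp A B C (g : term B C) (f : term A B) :
  arrow_comp (cls g) (cls f) = cls (g ∘ f).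
Proof. by apply/clsP/eqv_comp; apply: rep_cls. Qed.

Lemma arrow_comp_idl A B (f : arrow A B) : arrow_comp (arrow_id B) f = f.
Proof. by rewrite -[f]repK cls_comp; apply/clsP/eqv_idl. Qed.

Lemma arrow_comp_idr A B (f : arrow A B) : arrow_comp f (arrow_id A) = f.
Proof. by rewrite -[f]repK cls_comp; apply/clsP/eqv_idr. Qed.

Lemma arrow_comp_assoc A B C D
    (h : arrow C D) (g : arrow B C) (f : arrow A B) :
  arrow_comp h (arrow_comp g f) = arrow_comp (arrow_comp h g) f.
Proof.
by rewrite -[f]repK -[g]repK -[h]repK !cls_comp; apply/clsP/eqv_assoc.
Qed.

Definition LR : category :=
  Category arrow_comp_idl arrow_comp_idr arrow_comp_assoc.

Fixpoint Gobj (A : form) : nat :=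
  match A with
  | Letter _ => 0
  | Unit => 0
  | Tensor A B => Gobj A + Gobj B
  | EF _ A => (Gobj A).+1
  end.

Fixpoint Gterm A B (f : term A B) : {ffun 'I_(Gobj A) -> 'I_(Gobj B)} :=
  match f with
  | tid A => fun_id (Gobj A)
  | ta A B C => fun_cast (esym (addnA (Gobj A) (Gobj B) (Gobj C)))
  | tl A => fun_cast (add0n (Gobj A))
  | tr A => fun_cast (addn0 (Gobj A))
  | ta_inv A B C => fun_cast (addnA (Gobj A) (Gobj B) (Gobj C))
  | tl_inv A => fun_cast (esym (add0n (Gobj A)))
  | tr_inv A => fun_cast (esym (addn0 (Gobj A)))
  | tpsi _ A B => fun_psi (Gobj A) (Gobj B)
  | tcomp _ _ _ g f => fun_comp (Gterm g) (Gterm f)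
  | tten _ _ _ _ f g => fun_sum (Gterm f) (Gterm g)
  | tE _ _ _ f => fun_succ (Gterm f)
  end.

Lemma fun_sumL m n p q (f : {ffun 'I_m -> 'I_n}) (g : {ffun 'I_p -> 'I_q}) k :
  fun_sum f g (lshift p k) = lshift q (f k).
Proof. by rewrite ffunE (unsplitK (inl k)). Qed.

Lemma fun_sumR m n p q (f : {ffun 'I_m -> 'I_n}) (g : {ffun 'I_p -> 'I_q}) k :
  fun_sum f g (rshift m k) = rshift n (g k).
Proof. by rewrite ffunE (unsplitK (inr k)). Qed.

Lemma fun_succ0 m n (f : {ffun 'I_m -> 'I_n}) : fun_succ f ord0 = ord0.
Proof. by rewrite ffunE unlift_none. Qed.

Lemma fun_succS m n (f : {ffun 'I_m -> 'I_n}) k :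
  fun_succ f (lift ord0 k) = lift ord0 (f k).
Proof. by rewrite ffunE liftK. Qed.

Lemma fun_psiL m n k : fun_psi m n (lshift n.+1 k) = lift ord0 (lshift n k).
Proof. by rewrite ffunE (unsplitK (inl k)). Qed.

Lemma fun_psi0 m n : fun_psi m n (rshift m ord0) = ord0.
Proof. by rewrite ffunE (unsplitK (inr _)) unlift_none. Qed.

Lemma fun_psiR m n k :
  fun_psi m n (rshift m (lift ord0 k)) = lift ord0 (rshift m k).
Proof. by rewrite ffunE (unsplitK (inr _)) liftK. Qed.

Definition fun_blockE := (fun_sumL, fun_sumR, fun_succ0, fun_succS,
  fun_psiL, fun_psi0, fun_psiR).

Lemma cast_ord_assocL m n p k :
  cast_ord (esym (addnA m n p)) (lshift p (lshift n k)) = lshift (n + p) k.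
Proof. exact: val_inj. Qed.

Lemma cast_ord_assocM m n p k :
  cast_ord (esym (addnA m n p)) (lshift p (rshift m k)) =
  rshift m (lshift p k).
Proof. exact: val_inj. Qed.

Lemma cast_ord_assocR m n p k :
  cast_ord (esym (addnA m n p)) (rshift (m + n) k) = rshift m (rshift n k).
Proof. by apply: val_inj; rewrite /= addnA. Qed.

Definition cast_ordE := (cast_ord_assocL, cast_ord_assocM, cast_ord_assocR).

Lemma cast_add0n n (k : 'I_n) : cast_ord (add0n n) (rshift 0 k) = k.
Proof. exact: val_inj. Qed.

Lemma cast_addn0 n (k : 'I_n) : cast_ord (addn0 n) (lshift 0 k) = k.
Proof. exact: val_inj. Qed.

Lemma fun_castE m n (e : m = n) i : fun_cast e i = cast_ord e i.
Proof. by rewrite ffunE. Qed.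

Lemma fun_compE m n p (g : {ffun 'I_n -> 'I_p}) (f : {ffun 'I_m -> 'I_n}) i :
  fun_comp g f i = g (f i).
Proof. by rewrite ffunE. Qed.

Lemma fun_idE n i : fun_id n i = i.
Proof. by rewrite ffunE. Qed.

Definition fun_pointE := (fun_compE, fun_idE, fun_castE, fun_blockE, cast_ordE).

Lemma Gterm_eqv A B (f g : term A B) : f ≈ g -> Gterm f = Gterm g.
Proof.
elim=> {A B f g} //=.
- by move=> A B f g h _ -> _ ->.
- by move=> A B C g g' f f' _ -> _ ->.
- by move=> A B C D f f' g g' _ -> _ ->.
- by move=> i A B f f' _ ->.
- by move=> A B f; apply: fun_comp_idl.
- by move=> A B f; apply: fun_comp_idr.
- by move=> A B C D h g f; apply: fun_comp_assoc.
- by move=> A B; apply/ffunP => i; case: (split_ordP i) => k ->;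
    rewrite !fun_pointE.
- by move=> *; apply/ffunP => i; case: (split_ordP i) => k ->;
    rewrite !fun_pointE.
- move=> *; apply/ffunP => i; case: (split_ordP i) => k ->;
    last by rewrite !fun_pointE.
  by case: (split_ordP k) => j ->; rewrite !fun_pointE.
- move=> A B f; apply/ffunP => i; case: (split_ordP i) => k ->; first by case: k.
  by rewrite !fun_pointE !cast_add0n.
- move=> A B f; apply/ffunP => i; case: (split_ordP i) => k ->; last by case: k.
  by rewrite !fun_pointE !cast_addn0.
- by move=> A B C; apply/ffunP => i; apply: val_inj; rewrite !ffunE.
- by move=> A B C; apply/ffunP => i; apply: val_inj; rewrite !ffunE.
- by move=> A; apply/ffunP => i; apply: val_inj; rewrite !ffunE.
- by move=> A; apply/ffunP => i; apply: val_inj; rewrite !ffunE.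
- by move=> A; apply/ffunP => i; apply: val_inj; rewrite !ffunE.
- by move=> A; apply/ffunP => i; apply: val_inj; rewrite !ffunE.
- move=> A B C D; apply/ffunP => i; case: (split_ordP i) => k ->;
    last by rewrite !fun_pointE.
  case: (split_ordP k) => j ->; last by rewrite !fun_pointE.
  by case: (split_ordP j) => j' ->; rewrite !fun_pointE.
- move=> A B; apply/ffunP => i; case: (split_ordP i) => k ->.
    case: (split_ordP k) => j ->; last by case: j.
    by rewrite !fun_pointE cast_addn0.
  by rewrite !fun_pointE cast_add0n.
- move=> _ A; apply/ffunP => i; case: (unliftP ord0 i) => [k|] ->;
    by rewrite !fun_pointE.
- move=> *; apply/ffunP => i; case: (unliftP ord0 i) => [k|] ->;
    by rewrite !fun_pointE.
- move=> *; apply/ffunP => i; case: (split_ordP i) => k ->;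
    first by rewrite !fun_pointE.
  by case: (unliftP ord0 k) => [j|] ->; rewrite !fun_pointE.
- move=> _ A B C; apply/ffunP => i; case: (split_ordP i) => k ->.
    by case: (split_ordP k) => j ->; rewrite !fun_pointE.
  by case: (unliftP ord0 k) => [j|] ->; rewrite !fun_pointE.
- move=> _ A; apply/ffunP => i; case: (split_ordP i) => k ->; first by case: k.
  by case: (unliftP ord0 k) => [j|] ->; rewrite !fun_pointE; apply: val_inj.
Qed.

Definition Gmap A B (f : arrow A B) : {ffun 'I_(Gobj A) -> 'I_(Gobj B)} :=
  Gterm (rep f).

Lemma Gmap_cls A B (f : term A B) : Gmap (cls f) = Gterm f.
Proof. exact/Gterm_eqv/rep_cls. Qed.

Lemma Gmap_id A : Gmap (arrow_id A) = fun_id (Gobj A).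
Proof. exact: Gmap_cls. Qed.

Lemma Gmap_comp A B C (g : arrow B C) (f : arrow A B) :
  Gmap (arrow_comp g f) = fun_comp (Gmap g) (Gmap f).
Proof. exact: Gmap_cls. Qed.

Definition G : functor LR Fun :=
  @Functor LR Fun Gobj Gmap Gmap_id Gmap_comp.

End LR.

(* Main.v *)
From mathcomp Require Import all_boot boolp.
Require Import Defs.

Set Implicit Arguments.
Unset Strict Implicit.
Unset Printing Implicit Defensive.

(** Every formula is coherently isomorphic to a list of trees: tensor becomes
    concatenation, the letters are leaves and an occurrence of [E^i] is a node
    whose children are the trees of its argument. On lists, [psi] moves the
    roots that stand to the left of a node into that node, in front of its
    children. No generating arrow changes the postorder of the nodes and leaves,
    and this determines an arrow from its source and target, by recursion on
    the target. If the target is a node with children [D] followed by [M], then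
    the source is a list of absorbed roots, followed by a node with children
    [C], followed by a remainder [N'], and the arrow moves those roots into the
    node, then acts on the children and on the remainder separately. How many
    roots are absorbed is not a choice: arrows preserve the number of nodes and
    leaves, so the remainder [N'] has the same number of them as [M], and only
    one cut of the source leaves such a remainder.

    Arrows of this shape are called [canonical]. By [canonical_uniq] there is at
    most one between two given lists. They compose ([canonical_comp]), which
    rests on [split_split]: absorbing roots in two stages is the same as
    absorbing them at once and then regrouping inside. By [canonical_term] every
    arrow term is carried by the normalisation arrows [normalize] to a canonical
    arrow. As [normalize] is a split monomorphism, parallel arrows are equal
    ([arrow_uniq]), and faithfulness of [G] is immediate.

    The lists are themselves formulae, bracketed to the right and ending in the
    unit. A formula [A] is normalised in front of a list [N], giving
    [prepend A N]; associativity and the unit laws of [prepend] then hold by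
    computation, so that the structural isomorphisms become identities and no
    transport between equal formulae is needed. *)

Section Coherence.

Variables P J : Type.

Local Notation form := (form P J).
Local Notation Arr := (@arrow P J).
Local Notation I := (Unit P J).
Local Notation "A ⊠ B" := (Tensor A B) (at level 40, left associativity).
Local Notation "g ∘ f" := (arrow_comp g f) (at level 40, left associativity).
Local Notation "1_[ A ]" := (arrow_id A) (format "1_[ A ]").

Implicit Types A B C D N M : form.

(** * The structure of L^R on equivalence classes *)

Definition arrow_ten A B C D (f : Arr A B) (g : Arr C D) : Arr (A ⊠ C) (B ⊠ D) :=
  cls (tten (rep f) (rep g)).
Definition arrow_E i A B (f : Arr A B) : Arr (EF i A) (EF i B) :=
  cls (tE i (rep f)).

Local Notation "f ⊗ g" := (arrow_ten f g) (at level 39, left associativity).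

Definition assoc A B C : Arr (A ⊠ B ⊠ C) (A ⊠ (B ⊠ C)) := cls (ta A B C).
Definition assocV A B C : Arr (A ⊠ (B ⊠ C)) (A ⊠ B ⊠ C) := cls (ta_inv A B C).
Definition lunit A : Arr (I ⊠ A) A := cls (tl A).
Definition lunitV A : Arr A (I ⊠ A) := cls (tl_inv A).
Definition runit A : Arr (A ⊠ I) A := cls (tr A).
Definition runitV A : Arr A (A ⊠ I) := cls (tr_inv A).
Definition psi i A B : Arr (A ⊠ EF i B) (EF i (A ⊠ B)) := cls (tpsi i A B).

Lemma comp_cls A B C (g : Arr B C) (f : Arr A B) t u :
  g = cls t -> f = cls u -> g ∘ f = cls (tcomp t u).
Proof. by move=> -> ->; apply: cls_comp. Qed.

Lemma ten_cls A B C D (f : Arr A B) (g : Arr C D) t u :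
  f = cls t -> g = cls u -> f ⊗ g = cls (tten t u).
Proof. by move=> -> ->; apply/clsP/eqv_ten; apply: rep_cls. Qed.

Lemma E_cls i A B (f : Arr A B) t : f = cls t -> arrow_E i f = cls (tE i t).
Proof. by move=> ->; apply/clsP/eqv_E/rep_cls. Qed.

Lemma eqv_eq A B (f g : Arr A B) t u : f = cls t -> g = cls u -> eqv t u -> f = g.
Proof. by move=> -> -> /clsP. Qed.

(** [name_term] solves [f = cls ?t], where [f] is built from arrows by the
    operations of L^R, by instantiating [?t] with the corresponding term;
    [by_eqv] thus reduces an equation between arrows to one of the generating
    equations between terms. *)
Ltac name_term :=
  lazymatch goal with
  | |- arrow_comp _ _ = _ => eapply comp_cls; name_term
  | |- arrow_ten _ _ = _ => eapply ten_cls; name_term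
  | |- arrow_E _ _ = _ => eapply E_cls; name_term
  | |- ?f = _ => first [is_var f; exact (esym (repK f)) | reflexivity]
  end.
Ltac by_eqv ax := eapply eqv_eq; [name_term | name_term | exact: ax].

Lemma compA A B C D (h : Arr C D) (g : Arr B C) (f : Arr A B) :
  h ∘ (g ∘ f) = h ∘ g ∘ f.
Proof. exact: arrow_comp_assoc. Qed.

Lemma comp1f A B (f : Arr A B) : 1_[B] ∘ f = f.
Proof. exact: arrow_comp_idl. Qed.

Lemma compf1 A B (f : Arr A B) : f ∘ 1_[A] = f.
Proof. exact: arrow_comp_idr. Qed.

Lemma ten1 A B : 1_[A] ⊗ 1_[B] = 1_[A ⊠ B].
Proof. by_eqv eqv_ten_id. Qed.

Lemma tenM A B C A' B' C'
    (g : Arr B C) (f : Arr A B) (g' : Arr B' C') (f' : Arr A' B') :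
  (g ∘ f) ⊗ (g' ∘ f') = (g ⊗ g') ∘ (f ⊗ f').
Proof. by_eqv eqv_ten_comp. Qed.

Lemma assoc_nat A B C A' B' C' (f : Arr A A') (g : Arr B B') (h : Arr C C') :
  assoc A' B' C' ∘ (f ⊗ g ⊗ h) = (f ⊗ (g ⊗ h)) ∘ assoc A B C.
Proof. by_eqv eqv_a_nat. Qed.

Lemma lunit_nat A B (f : Arr A B) : lunit B ∘ (1_[I] ⊗ f) = f ∘ lunit A.
Proof. by_eqv eqv_l_nat. Qed.

Lemma runit_nat A B (f : Arr A B) : runit B ∘ (f ⊗ 1_[I]) = f ∘ runit A.
Proof. by_eqv eqv_r_nat. Qed.

Lemma assocK A B C : assocV A B C ∘ assoc A B C = 1_[A ⊠ B ⊠ C].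
Proof. by_eqv eqv_aK. Qed.

Lemma assocVK A B C : assoc A B C ∘ assocV A B C = 1_[A ⊠ (B ⊠ C)].
Proof. by_eqv eqv_aVK. Qed.

Lemma lunitK A : lunitV A ∘ lunit A = 1_[I ⊠ A].
Proof. by_eqv eqv_lK. Qed.

Lemma lunitVK A : lunit A ∘ lunitV A = 1_[A].
Proof. by_eqv eqv_lVK. Qed.

Lemma runitK A : runitV A ∘ runit A = 1_[A ⊠ I].
Proof. by_eqv eqv_rK. Qed.

Lemma runitVK A : runit A ∘ runitV A = 1_[A].
Proof. by_eqv eqv_rVK. Qed.

Lemma pentagon A B C D :
  assoc A B (C ⊠ D) ∘ assoc (A ⊠ B) C D =
  (1_[A] ⊗ assoc B C D) ∘ assoc A (B ⊠ C) D ∘ (assoc A B C ⊗ 1_[D]).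
Proof. by_eqv eqv_pentagon. Qed.

Lemma triangle A B : (1_[A] ⊗ lunit B) ∘ assoc A I B = runit A ⊗ 1_[B].
Proof. by_eqv eqv_triangle. Qed.

Lemma arrow_E1 i A : arrow_E i 1_[A] = 1_[EF i A].
Proof. by_eqv eqv_E_id. Qed.

Lemma arrow_EM i A B C (g : Arr B C) (f : Arr A B) :
  arrow_E i (g ∘ f) = arrow_E i g ∘ arrow_E i f.
Proof. by_eqv eqv_E_comp. Qed.

Lemma psi_nat i A B A' B' (f : Arr A A') (g : Arr B B') :
  psi i A' B' ∘ (f ⊗ arrow_E i g) = arrow_E i (f ⊗ g) ∘ psi i A B.
Proof. by_eqv eqv_psi_nat. Qed.

Lemma psi_assoc i A B C :
  arrow_E i (assoc A B C) ∘ psi i (A ⊠ B) C =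
  psi i A (B ⊠ C) ∘ (1_[A] ⊗ psi i B C) ∘ assoc A B (EF i C).
Proof. by_eqv eqv_psi_a. Qed.

Lemma psi_lunit i A :
  arrow_E i (lunit A) ∘ psi i I A = lunit (EF i A).
Proof. by_eqv eqv_psi_l. Qed.

(** * Consequences of the monoidal axioms *)

Lemma tenMl A B C D (g : Arr B C) (f : Arr A B) :
  (g ∘ f) ⊗ 1_[D] = (g ⊗ 1_[D]) ∘ (f ⊗ 1_[D]).
Proof. by rewrite -tenM comp1f. Qed.

Lemma tenMr A B C D (g : Arr B C) (f : Arr A B) :
  1_[D] ⊗ (g ∘ f) = (1_[D] ⊗ g) ∘ (1_[D] ⊗ f).
Proof. by rewrite -tenM comp1f. Qed.

Lemma comp_assoc_inj A B C D (f g : Arr (A ⊠ (B ⊠ C)) D) :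
  f ∘ assoc A B C = g ∘ assoc A B C -> f = g.
Proof.
by move/(congr1 (fun h => h ∘ assocV A B C)); rewrite -!compA assocVK !compf1.
Qed.

Lemma assoc_comp_inj A B C D (f g : Arr D (A ⊠ B ⊠ C)) :
  assoc A B C ∘ f = assoc A B C ∘ g -> f = g.
Proof.
by move/(congr1 (fun h => assocV A B C ∘ h)); rewrite !compA assocK !comp1f.
Qed.

Lemma ten1I_inj A B (f g : Arr A B) : f ⊗ 1_[I] = g ⊗ 1_[I] -> f = g.
Proof.
move/(congr1 (fun h => runit B ∘ h ∘ runitV A)).
by rewrite !runit_nat -!compA runitVK !compf1.
Qed.

Lemma tenI1_inj A B (f g : Arr A B) : 1_[I] ⊗ f = 1_[I] ⊗ g -> f = g.
Proof.
move/(congr1 (fun h => lunit B ∘ h ∘ lunitV A)).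
by rewrite !lunit_nat -!compA lunitVK !compf1.
Qed.

Lemma assocV_nat A B C A' B' C' (f : Arr A A') (g : Arr B B') (h : Arr C C') :
  assocV A' B' C' ∘ (f ⊗ (g ⊗ h)) = (f ⊗ g ⊗ h) ∘ assocV A B C.
Proof.
apply: comp_assoc_inj; rewrite -!compA assocK compf1 -assoc_nat compA.
by rewrite assocK comp1f.
Qed.

Lemma runitV_nat A B (f : Arr A B) : (f ⊗ 1_[I]) ∘ runitV A = runitV B ∘ f.
Proof.
rewrite -[LHS]comp1f -runitK -!compA [runit B ∘ _]compA runit_nat.
by rewrite -compA runitVK compf1.
Qed.

Lemma pentagonV A B C D :
  (assoc A B C ⊗ 1_[D]) ∘ assocV (A ⊠ B) C D =
  assocV A (B ⊠ C) D ∘ (1_[A] ⊗ assocV B C D) ∘ assoc A B (C ⊠ D).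
Proof.
apply: comp_assoc_inj; rewrite -!compA pentagon assocK compf1.
rewrite !compA -[_ ∘ (1_[A] ⊗ assocV _ _ _) ∘ _]compA -tenMr assocK ten1 compf1.
by rewrite assocK comp1f.
Qed.

(** Kelly's argument: tensoring with the unit is injective on arrows, and after
    it the equation is what the pentagon for [I, I, A, B] and two triangles
    say. *)
Lemma lunit_tensor A B : lunit (A ⊠ B) ∘ assoc I A B = lunit A ⊗ 1_[B].
Proof.
apply: tenI1_inj.
suff E : (1_[I] ⊗ (lunit (A ⊠ B) ∘ assoc I A B)) ∘ assoc I (I ⊠ A) B ∘
    (assoc I I A ⊗ 1_[B]) =
    (1_[I] ⊗ (lunit A ⊗ 1_[B])) ∘ assoc I (I ⊠ A) B ∘ (assoc I I A ⊗ 1_[B]).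
  apply: comp_assoc_inj.
  move/(congr1 (fun h => h ∘ (assocV I I A ⊗ 1_[B]))): E.
  by rewrite -!compA -tenMl assocVK ten1 !compf1.
rewrite tenMr -!compA [_ ∘ (_ ∘ (assoc I I A ⊗ _))]compA -pentagon.
rewrite compA triangle -ten1 -assoc_nat -triangle tenMl compA assoc_nat.
by rewrite -!compA.
Qed.

(** The mirror image of [lunit_tensor], from the pentagon for [A, B, I, I]. *)
Lemma runit_tensor A B : (1_[A] ⊗ runit B) ∘ assoc A B I = runit (A ⊠ B).
Proof.
apply: ten1I_inj; apply: assoc_comp_inj.
rewrite tenMl compA assoc_nat -triangle tenMr -!compA.
rewrite [(1_[A] ⊗ assoc _ _ _) ∘ _]compA -pentagon compA -assoc_nat ten1.
by rewrite -!compA triangle.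
Qed.

Lemma runitV_tensor A B : assoc A B I ∘ runitV (A ⊠ B) = 1_[A] ⊗ runitV B.
Proof.
rewrite -[LHS]comp1f -ten1 -runitK tenMr -!compA.
by rewrite [_ ∘ (assoc _ _ _ ∘ _)]compA runit_tensor runitVK compf1.
Qed.

(** * Absorbing a formula on the left of a node *)

(** If [s] exhibits a node at the head of [N], after absorption of all that
    precedes it, then [shift A s] makes the same node absorb [A] as well. The
    lock keeps [shift] atomic when equations are rewritten by unification. *)
Definition shift A i N C D (s : Arr N (EF i C ⊠ D)) :
    Arr (A ⊠ N) (EF i (A ⊠ C) ⊠ D) :=
  locked ((psi i A C ⊗ 1_[D]) ∘ assocV A (EF i C) D ∘ (1_[A] ⊗ s)).

Lemma shiftE A i N C D (s : Arr N (EF i C ⊠ D)) :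
  shift A s = (psi i A C ⊗ 1_[D]) ∘ assocV A (EF i C) D ∘ (1_[A] ⊗ s).
Proof. by rewrite /shift -lock. Qed.

Lemma shift_nat i A A' N N' C C' D D' (s : Arr N (EF i C ⊠ D))
    (s' : Arr N' (EF i C' ⊠ D')) (h : Arr A A') (f : Arr N N')
    (f1 : Arr C C') (f2 : Arr D D') :
  s' ∘ f = (arrow_E i f1 ⊗ f2) ∘ s ->
  shift A' s' ∘ (h ⊗ f) = (arrow_E i (h ⊗ f1) ⊗ f2) ∘ shift A s.
Proof.
move=> e; rewrite !shiftE -!compA -tenM e comp1f -[h]compf1 tenM compf1.
rewrite [assocV _ _ _ ∘ _]compA assocV_nat !compA -tenM psi_nat comp1f.
by rewrite -tenM compf1.
Qed.

(** This is where the axiom relating [psi] and associativity is used. *)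
Lemma shift_tensor i A B N C D (s : Arr N (EF i C ⊠ D)) :
  (arrow_E i (assoc A B C) ⊗ 1_[D]) ∘ shift (A ⊠ B) s =
  shift A (shift B s) ∘ assoc A B N.
Proof.
rewrite !shiftE !compA -tenMl psi_assoc !tenMl !tenMr -!compA.
rewrite -assoc_nat ten1; congr (_ ∘ _).
rewrite [assocV A _ D ∘ _]compA assocV_nat -!compA; congr (_ ∘ _).
by rewrite !compA pentagonV.
Qed.

(** This is where the axiom relating [psi] and the left unit is used. *)
Lemma shift_unit i N C D (s : Arr N (EF i C ⊠ D)) :
  (arrow_E i (lunit C) ⊗ 1_[D]) ∘ shift I s = s ∘ lunit N.
Proof.
rewrite !shiftE !compA -tenMl psi_lunit -lunit_tensor -[_ ∘ assocV _ _ _]compA.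
by rewrite assocVK compf1 lunit_nat.
Qed.

(** The trivial instance of the hypothesis of [shift_nat]. *)
Lemma square_id i N C D (s : Arr N (EF i C ⊠ D)) :
  s ∘ 1_[N] = (arrow_E i 1_[C] ⊗ 1_[D]) ∘ s.
Proof. by rewrite arrow_E1 ten1 comp1f compf1. Qed.

Lemma shift_id i A B N : shift A 1_[EF i B ⊠ N] ∘ assoc A (EF i B) N = psi i A B ⊗ 1_[N].
Proof. by rewrite shiftE ten1 compf1 -compA assocK compf1. Qed.

Lemma shift_tensorV i A B N C D (s : Arr N (EF i C ⊠ D)) :
  shift (A ⊠ B) s ∘ assocV A B N =
  (arrow_E i (assocV A B C) ⊗ 1_[D]) ∘ shift A (shift B s).
Proof.
apply: comp_assoc_inj; rewrite -!compA assocK compf1 -shift_tensor compA.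
by rewrite -tenMl -arrow_EM assocK arrow_E1 ten1 comp1f.
Qed.

(** * Canonical arrows *)

(** Equality in a dependent family may be tested by predicates on the whole
    family; for arbitrary index types this needs uniqueness of equality
    proofs. *)
Lemma leibniz_fiber (K : Type) (T : K -> Type) (k : K) (x y : T k) :
  (forall Q : (forall k, T k -> Prop), Q k x -> Q k y) -> x = y.
Proof.
move=> H; pose Q j (z : T j) := forall e : j = k, x = eq_rect j T z k e.
have /(_ erefl) // : Q k y by apply: (H Q) => e; rewrite (Prop_irrelevance e erefl).
Qed.

(** The ways of bringing a root [A] of the list [N] to the head, [M] being the
    part of [N] to the right of it: either it is at the head already, or it is
    a node that absorbs all the roots on its left, one at a time. *)
Inductive split : forall N A M, Arr N (A ⊠ M) -> Prop :=
| split_head A N : split 1_[A ⊠ N]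
| split_shift A i N C D (s : Arr N (EF i C ⊠ D)) :
    split s -> split (shift A s).

(** Arrows between lists ([canonical]) and between single trees
    ([head_canonical]), in the shape determined by the target. *)
Inductive canonical : forall N M, Arr N M -> Prop :=
| canonical_unit : canonical 1_[I]
| canonical_tensor N A B N' M (t : Arr N (A ⊠ N')) (h : Arr A B) (f : Arr N' M) :
    split t -> head_canonical h -> canonical f -> canonical ((h ⊗ f) ∘ t)
with head_canonical : forall A B, Arr A B -> Prop :=
| head_letter p : head_canonical 1_[Letter J p]
| head_E i N M (f : Arr N M) : canonical f -> head_canonical (arrow_E i f).

Scheme canonical_mut := Induction for canonical Sort Prop
with head_canonical_mut := Induction for head_canonical Sort Prop.

(** In this and the next two lemmas, inversion is by matching on the formulae.
    Where an index of [f] is itself determined by the inversion, equality is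
    replaced by a quantification over predicates [Q] on all values of that index,
    which can be used without transport. *)
Lemma canonical_inv N M (f : Arr N M) : canonical f ->
  match M return Arr N M -> Prop with
  | Unit => match N return Arr N I -> Prop with
            | Unit => fun f => f = 1_[I]
            | _ => fun _ => False
            end
  | Tensor B M => fun f => exists A N' (t : Arr N (A ⊠ N')) (h : Arr A B)
      (f' : Arr N' M), [/\ split t, head_canonical h, canonical f'
                         & f = (h ⊗ f') ∘ t]
  | _ => fun _ => False
  end f.
Proof. by case=> // *; do 5!eexists; split; eassumption || reflexivity. Qed.

Lemma head_canonical_inv A B (h : Arr A B) : head_canonical h ->
  match B return Arr A B -> Prop with
  | Letter p => match A return Arr A (Letter J p) -> Prop with
      | Letter q => fun h => forall Q : (forall q, Arr (Letter J q) (Letter J p) -> Prop),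
          Q p 1_[Letter J p] -> Q q h
      | _ => fun _ => False end
  | EF j M => match A return Arr A (EF j M) -> Prop with
      | EF i N => fun h => forall Q : (forall i, Arr (EF i N) (EF j M) -> Prop),
          (forall f, canonical f -> Q j (arrow_E j f)) -> Q i h
      | _ => fun _ => False end
  | _ => fun _ => False
  end h.
Proof. by case=> // i N M f cf Q; apply. Qed.

Lemma split_inv N A M (t : Arr N (A ⊠ M)) : split t ->
  match N return Arr N (A ⊠ M) -> Prop with
  | Tensor B N' => fun t =>
      (forall Q : (forall A M, Arr (B ⊠ N') (A ⊠ M) -> Prop),
         Q B N' 1_[B ⊠ N'] -> Q A M t) \/
      exists i C (s : Arr N' (EF i C ⊠ M)), split s /\
      forall Q : (forall A M, Arr (B ⊠ N') (A ⊠ M) -> Prop),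
         Q (EF i (B ⊠ C)) M (shift B s) -> Q A M t
  | _ => fun _ => False
  end t.
Proof.
case=> [B N'|B i N' C D s ss]; first by left.
by right; exists i, C, s; split.
Qed.

(** The number of nodes and leaves, the invariant that locates the cut. *)
Fixpoint weight A : nat :=
  match A with
  | Letter _ => 1
  | Unit => 0
  | Tensor A B => weight A + weight B
  | EF _ A => (weight A).+1
  end.

Lemma split_weight N A M (t : Arr N (A ⊠ M)) : split t -> weight N = weight A + weight M.
Proof. by elim=> //= B i N' C D s _ ->; rewrite /= addSn addnS addnA. Qed.

Lemma canonical_weight N M (f : Arr N M) : canonical f -> weight N = weight M.
Proof.
move: N M f; apply (canonical_mut
  (P0 := fun A B (_ : Arr A B) _ => weight A = weight B)) => //=.
- by move=> N A B N' M t h f /split_weight -> _ -> _ ->.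
- by move=> i N M f _ ->.
Qed.

(** Absorbing one more root strictly decreases the weight of the remainder, since
    the remainder loses at least the absorbing node; so the weight tells how many
    roots are absorbed. *)
Lemma split_uniq N A M (t : Arr N (A ⊠ M)) A' M' (t' : Arr N (A' ⊠ M')) :
  split t -> split t' -> weight M = weight M' ->
  forall Q : (forall A M, Arr N (A ⊠ M) -> Prop), Q A M t -> Q A' M' t'.
Proof.
move=> st; elim: st A' M' t' => {N A M t} [B N|B i N C D s ss IH] A' M' t'.
  move=> /split_inv [H|[i [C [s [ss H]]]]] e Q; first exact: H.
  by move: (split_weight ss) => /= /eqP; rewrite e -[X in X == _]add0n eqn_add2r.
move=> /split_inv [H|[j [C' [s' [ss' H]]]]] e Q Qs.
  move: e; apply: (H (fun A' M' t' => weight D = weight M' -> Q A' M' t')) => e.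
  by move: (split_weight ss) => /= /eqP; rewrite e -[X in X == _]add0n eqn_add2r.
apply: H.
(* On heads that are nodes, [R] is [Q] after absorption of [B]; other heads do
   not occur. *)
pose R X Y (t : Arr N (X ⊠ Y)) := match X return Arr N (X ⊠ Y) -> Prop with
  | EF k Z => fun t => Q _ _ (shift B t) | _ => fun _ => True end t.
exact: (IH _ _ _ ss' e R).
Qed.

(** Induction on the first arrow. Both cuts of the source leave a remainder of the
    weight of the tail of the target, so they coincide by [split_uniq], and the
    induction hypotheses apply to the components. *)
Lemma canonical_uniq N M (f g : Arr N M) : canonical f -> canonical g -> f = g.
Proof.
move=> cf; move: N M f cf g; apply (canonical_mut
  (P := fun N M f _ => forall g : Arr N M, canonical g -> f = g)
  (P0 := fun A B h _ => forall k : Arr A B, head_canonical k -> h = k)).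
- by move=> g /canonical_inv.
- move=> N A B N' M t h f st ch IHh cf IHf g /canonical_inv.
  move=> [A' [N'' [t' [h' [f' [st' ch' cf' ->]]]]]].
  have e : weight N' = weight N'' by rewrite (canonical_weight cf) (canonical_weight cf').
  move: h' f' ch' cf'; apply: (split_uniq st st' e
    (Q := fun A' N' t' => forall h' f', head_canonical h' -> canonical f' ->
       (h ⊗ f) ∘ t = (h' ⊗ f') ∘ t')).
  by move=> h' f' /IHh -> /IHf ->.
- move=> p k /head_canonical_inv H.
  exact: (leibniz_fiber H).
- move=> i N M f cf IH k /head_canonical_inv H.
  apply: (leibniz_fiber (T := fun j => Arr (EF j N) (EF i M))) => Q Qf.
  by apply: H => g /IH <-.
Qed.

(** Two-stage absorption. If [A] is brought to the head of [N], leaving [M], and a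
    node of [M] then absorbs everything before it, including [A], then the same
    is obtained when this node absorbs all the roots on its left in [N] at once
    ([u]) and [A] is brought to the head among its children afterwards ([v]).
    Each root [B] that a node [A] absorbs is passed over by naturality of
    [shift] along [psi] and by [shift_tensor]. *)
Lemma split_split N A M (t : Arr N (A ⊠ M)) i C D (s : Arr M (EF i C ⊠ D)) :
  split t -> split s ->
  exists C' (u : Arr N (EF i C' ⊠ D)) (v : Arr C' (A ⊠ C)),
    [/\ split u, split v & shift A s ∘ t = (arrow_E i v ⊗ 1_[D]) ∘ u].
Proof.
move=> st ss; elim: st s ss => {N A M t} [A M|B j N C0 D0 s0 ss0 IH] s ss.
  exists (A ⊠ C), (shift A s), 1_[_].
  by split; [exact: split_shift|exact: split_head|exact: square_id].
have [C' [u [v [su sv e]]]] := IH s ss.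
exists (B ⊠ C'), (shift B u), (shift B v).
split; [exact: split_shift|exact: split_shift|].
rewrite (shiftE B s0) !compA (shift_nat (psi j B C0) (square_id s)).
rewrite -[_ ∘ shift _ _ ∘ assocV _ _ _]compA shift_tensorV -!compA.
rewrite (shift_nat 1_[B] e) !compA -!tenMl -!arrow_EM.
by rewrite (shiftE B v).
Qed.

(** A cut of the target of a canonical arrow can be pulled back to its source. In
    the inductive step, the absorbed root [A] of the target comes from a root [B]
    brought to the head of [N] by [t], and the absorbing node from one in the
    remainder; [split_split] exchanges the two absorptions. *)
Lemma canonical_split N M (f : Arr N M) A M' (s : Arr M (A ⊠ M')) :
  split s -> canonical f ->
  exists B N' (t : Arr N (B ⊠ N')) (h : Arr B A) (f' : Arr N' M'),
    [/\ split t, head_canonical h, canonical f' & s ∘ f = (h ⊗ f') ∘ t].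
Proof.
move=> ss; elim: ss N f => {M A M' s} [A M|A i M C D s ss IH] N f
  /canonical_inv [B [N' [t [h [f' [st ch cf' ->]]]]]].
  by exists B, N', t, h, f'; rewrite comp1f.
have [X [N'' [t' [h' [f'' [st' ch' cf'' e]]]]]] := IH _ _ cf'.
case: X t' h' st' ch' e => [p||A1 A2|j C'] t' h' st' /head_canonical_inv // H e.
move: t' st' e.
apply: (H (fun j h' => forall t' : Arr N' (EF j C' ⊠ N''), split t' ->
  s ∘ f' = (h' ⊗ f'') ∘ t' -> _)) => {H h'} g cg t' st' e.
have [C'' [u [v [su sv e']]]] := split_split st st'.
exists (EF i C''), N'', u, (arrow_E i ((h ⊗ g) ∘ v)), f''; split=> //.
  exact/head_E/canonical_tensor.
rewrite compA (shift_nat h e) -compA e' compA -tenM compf1.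
by rewrite -arrow_EM.
Qed.

(** The cut that [g] makes in the middle list is pulled back along [f] by
    [canonical_split]; the components are then composed separately. *)
Lemma canonical_comp N M (g : Arr N M) : canonical g ->
  forall L (f : Arr L N), canonical f -> canonical (g ∘ f).
Proof.
move: N M g; apply (canonical_mut
  (P := fun N M g _ =>
     forall L (f : Arr L N), canonical f -> canonical (g ∘ f))
  (P0 := fun A B h _ =>
     forall C (k : Arr C A), head_canonical k -> head_canonical (h ∘ k))).
- by move=> L f cf; rewrite comp1f.
- move=> N A B N' M t h g st ch IHh cg IHg L f cf.
  have [C [L' [u [k [f' [su ck cf' e]]]]]] := canonical_split st cf.
  rewrite -compA e compA -tenM.
  by apply: canonical_tensor => //; [apply: IHh|apply: IHg].
- by move=> p C k ck; rewrite comp1f.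
- move=> i N M g cg IH [p||A1 A2|j C] k ck; have := head_canonical_inv ck => // H.
  apply: (H (fun j k => head_canonical (arrow_E i g ∘ k))) => f cf.
  by rewrite -arrow_EM; apply/head_E/IH.
Qed.

(** * Normalisation *)

(** The list [N] preceded by the trees of [A]. The second argument, as for
    difference lists, makes the associativity and unit laws computational. *)
Fixpoint prepend A N : form :=
  match A with
  | Letter _ => A ⊠ N
  | Unit => N
  | Tensor A B => prepend A (prepend B N)
  | EF i A => EF i (prepend A I) ⊠ N
  end.

Fixpoint normalize A N : Arr (A ⊠ N) (prepend A N) :=
  match A return Arr (A ⊠ N) (prepend A N) with
  | Letter p => 1_[Letter J p ⊠ N]
  | Unit => lunit N
  | Tensor A B => normalize A (prepend B N) ∘ (1_[A] ⊗ normalize B N) ∘ assoc A B N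
  | EF i A => arrow_E i (normalize A I ∘ runitV A) ⊗ 1_[N]
  end.

Lemma normalize_retraction A N : exists g, g ∘ normalize A N = 1_[A ⊠ N].
Proof.
elim: A N => [p||A IHA B IHB|i A IH] N /=.
- by exists 1_[_]; rewrite comp1f.
- by exists (lunitV N); exact: lunitK.
- have [gA eA] := IHA (prepend B N); have [gB eB] := IHB N.
  exists (assocV A B N ∘ (1_[A] ⊗ gB) ∘ gA).
  rewrite !compA -[_ ∘ gA ∘ _]compA eA compf1 -[_ ∘ _ ∘ (1_[A] ⊗ normalize B N)]compA.
  by rewrite -tenMr eB ten1 compf1 assocK.
- have [g e] := IH I; exists (arrow_E i (runit A ∘ g) ⊗ 1_[N]).
  rewrite -tenMl -arrow_EM -compA [g ∘ _]compA e comp1f runitVK arrow_E1.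
  exact: ten1.
Qed.

Lemma normalize_inj A N C (f g : Arr C (A ⊠ N)) : normalize A N ∘ f = normalize A N ∘ g -> f = g.
Proof.
have [k e] := normalize_retraction A N.
by move/(congr1 (arrow_comp k)); rewrite !compA e !comp1f.
Qed.

(** By this lemma and the next two, [normalize] turns the structural isomorphisms
    into identities of lists. *)
Lemma normalize_assoc A B C N :
  normalize (A ⊠ (B ⊠ C)) N ∘ (assoc A B C ⊗ 1_[N]) = normalize (A ⊠ B ⊠ C) N.
Proof.
rewrite /= !tenMr -!compA; do 2!congr (_ ∘ _).
rewrite [_ ∘ (assoc _ _ _ ∘ _)]compA.
rewrite [assoc _ _ _ ∘ ((1_[A ⊠ B] ⊗ _) ∘ _)]compA -ten1 assoc_nat.
by rewrite -!compA pentagon !compA.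
Qed.

Lemma normalize_lunit A N : normalize A N ∘ (lunit A ⊗ 1_[N]) = normalize (I ⊠ A) N.
Proof. by rewrite -lunit_tensor compA -lunit_nat. Qed.

Lemma normalize_runit A N : normalize A N ∘ (runit A ⊗ 1_[N]) = normalize (A ⊠ I) N.
Proof. by rewrite -triangle compA. Qed.

(** The node that [s] brings to the head of [N] can also absorb the trees of
    [A]. *)
Lemma normalize_split A N i C D (s : Arr N (EF i C ⊠ D)) : split s ->
  exists2 t : Arr (prepend A N) (EF i (prepend A C) ⊠ D), split t &
    t ∘ normalize A N = (arrow_E i (normalize A C) ⊗ 1_[D]) ∘ shift A s.
Proof.
elim: A N C s => [p||A IHA B IHB|j A IH] N C s ss /=.
- by exists (shift _ s); [exact: split_shift|exact: square_id].
- by exists s => //; rewrite shift_unit.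
- have [u su eu] := IHB _ _ _ ss; have [t st et] := IHA _ _ _ su.
  exists t => //; rewrite !compA et -[_ ∘ shift A u ∘ _]compA (shift_nat 1_[A] eu).
  by rewrite !arrow_EM !tenMl -!compA shift_tensor.
- exists (shift (EF j (prepend A I)) s); first exact: split_shift.
  exact: (shift_nat (arrow_E j (normalize A I ∘ runitV A)) (square_id s)).
Qed.

(** Identities are canonical on lists only; being the target of a canonical arrow
    witnesses that [M] is a list. *)
Lemma canonical_target N M (f : Arr N M) : canonical f -> canonical 1_[M].
Proof.
move: N M f; apply (canonical_mut
  (P := fun N M _ _ => canonical 1_[M])
  (P0 := fun A B _ _ => head_canonical 1_[B])).
- exact: canonical_unit.
- move=> N A B N' M t h f _ _ cB _ cM; rewrite -ten1 -[X in canonical X]compf1.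
  by apply: canonical_tensor => //; exact: split_head.
- exact: head_letter.
- by move=> i N M f _ cM; rewrite -arrow_E1; exact: head_E.
Qed.

(** The case of an identity term in [canonical_term]. *)
Lemma canonical_prepend A N M (f : Arr N M) : canonical f ->
  exists2 f' : Arr (prepend A N) (prepend A M), canonical f' &
    f' ∘ normalize A N = normalize A M ∘ (1_[A] ⊗ f).
Proof.
elim: A N M f => [p||A IHA B IHB|i A IH] N M f cf /=.
- exists ((1_[Letter J p] ⊗ f) ∘ 1_[Letter J p ⊠ N]); last by rewrite !compf1 comp1f.
  by apply: canonical_tensor => //; [exact: split_head|exact: head_letter].
- by exists f; rewrite ?lunit_nat.
- have [g cg eg] := IHB _ _ _ cf; have [k ck ek] := IHA _ _ _ cg.
  exists k => //; rewrite !compA ek -[_ ∘ _ ∘ (1_[A] ⊗ normalize B N)]compA -tenMr eg.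
  by rewrite tenMr -!compA -assoc_nat ten1.
- have [g cg eg] := IH _ _ _ canonical_unit.
  exists ((arrow_E i g ⊗ f) ∘ 1_[EF i (prepend A I) ⊠ N]).
    by apply: canonical_tensor => //; [exact: split_head|exact: head_E].
  rewrite compf1 -!tenM -!arrow_EM.
  by rewrite !compA eg ten1 !compf1 comp1f.
Qed.

Lemma canonical_id A : canonical 1_[prepend A I].
Proof. by have [f /canonical_target] := canonical_prepend A canonical_unit. Qed.

Lemma square_iso A B N M X Y (k : Arr X Y) (a : Arr (A ⊠ N) X)
    (b : Arr (A ⊠ M) Y) (b' : Arr (B ⊠ M) Y) (h : Arr A B) (f : Arr N M) :
  k ∘ a = b ∘ (1_[A] ⊗ f) -> b' ∘ (h ⊗ 1_[M]) = b -> k ∘ a = b' ∘ (h ⊗ f).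
Proof. by move=> -> <-; rewrite -compA -tenM compf1 comp1f. Qed.

Lemma square_iso_inv A B M Y (b : Arr (A ⊠ M) Y) (b' : Arr (B ⊠ M) Y)
    (h : Arr A B) (k : Arr B A) :
  h ∘ k = 1_[B] -> b' ∘ (h ⊗ 1_[M]) = b -> b ∘ (k ⊗ 1_[M]) = b'.
Proof. by move=> e <-; rewrite -compA -tenM e comp1f ten1 compf1. Qed.

(** Induction on the term. The structural isomorphisms are sent to the identity
    on [prepend], by the [normalize] lemmas above; composition is
    [canonical_comp]; for [psi] the cut is supplied by [normalize_split]. The
    canonical arrow [f] on the right is what makes the induction go through the
    tensor: the arrow obtained for the right factor is fed to the left one. *)
Lemma canonical_term A B (h : term A B) N M (f : Arr N M) : canonical f ->
  exists2 f' : Arr (prepend A N) (prepend B M), canonical f' &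
    f' ∘ normalize A N = normalize B M ∘ (cls h ⊗ f).
Proof.
elim: h N M f => {A B} [A|A B C|A|A|A B C|A|A|i A B|A B C h IHh k IHk
  |A B C D h IHh k IHk|i A B h IHh] N M f cf.
- exact: canonical_prepend.
- have [g cg e] := canonical_prepend (A ⊠ B ⊠ C) cf; exists g => //.
  exact: square_iso e (normalize_assoc _ _ _ _).
- have [g cg e] := canonical_prepend (I ⊠ A) cf; exists g => //.
  exact: square_iso e (normalize_lunit _ _).
- have [g cg e] := canonical_prepend (A ⊠ I) cf; exists g => //.
  exact: square_iso e (normalize_runit _ _).
- have [g cg e] := canonical_prepend (A ⊠ (B ⊠ C)) cf; exists g => //.
  apply: square_iso e _.
  exact: square_iso_inv (assocVK _ _ _) (normalize_assoc _ _ _ _).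
- have [g cg e] := canonical_prepend A cf; exists g => //.
  apply: square_iso e _; exact: square_iso_inv (lunitVK _) (normalize_lunit _ _).
- have [g cg e] := canonical_prepend A cf; exists g => //.
  apply: square_iso e _; exact: square_iso_inv (runitVK _) (normalize_runit _ _).
- have [t st et] := normalize_split A (split_head (EF i (prepend B I)) N).
  exists ((1_[EF i (prepend A (prepend B I))] ⊗ f) ∘ t).
    apply: canonical_tensor => //; rewrite -arrow_E1.
    exact/head_E/(canonical_id (A ⊠ B)).
  rewrite /= !compA -[_ ∘ t ∘ _]compA et.
  (* [x] normalises the argument of the node; it moves past the absorption of
     [A] by naturality. *)
  set x := normalize B I ∘ runitV B.
  have e : 1_[EF i (prepend B I) ⊠ N] ∘ (arrow_E i x ⊗ 1_[N]) =
      (arrow_E i x ⊗ 1_[N]) ∘ 1_[EF i B ⊠ N] by rewrite comp1f compf1.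
  rewrite -!compA [shift _ _ ∘ _]compA (shift_nat 1_[A] e) -compA shift_id.
  rewrite runitV_tensor -tenMr -/x -!tenM.
  by rewrite arrow_EM !compf1 !comp1f !compA.
- have [u cu eu] := IHk _ _ _ cf.
  have [v cv ev] := IHh _ _ _ (canonical_target cf).
  exists (v ∘ u); first exact: canonical_comp.
  by rewrite -cls_comp -compA eu compA ev -compA -tenM comp1f.
- have [u cu eu] := IHk _ _ _ cf; have [v cv ev] := IHh _ _ _ cu.
  exists v => //=; rewrite !compA ev -[_ ∘ _ ∘ (1_[A] ⊗ normalize C N)]compA -tenM eu compf1.
  rewrite -[cls h in LHS]comp1f tenM -!compA -assoc_nat.
  by rewrite -[cls (tten h k)](ten_cls (erefl (cls h)) (erefl (cls k))).
- have [g cg eg] := IHh _ _ _ canonical_unit.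
  exists ((arrow_E i g ⊗ f) ∘ 1_[EF i (prepend A I) ⊠ N]).
    by apply: canonical_tensor => //; [exact: split_head|exact: head_E].
  rewrite compf1 /= -[cls (tE i h)](E_cls _ (erefl (cls h))) -!tenM -!arrow_EM.
  by rewrite compf1 comp1f !compA eg -!compA runitV_nat.
Qed.

Lemma arrow_uniq A B (f g : Arr A B) : f = g.
Proof.
have [f' cf ef] := canonical_term (rep f) canonical_unit.
have [g' cg eg] := canonical_term (rep g) canonical_unit.
apply/ten1I_inj/normalize_inj.
by rewrite !repK in ef eg; rewrite -ef -eg (canonical_uniq cf cg).
Qed.

End Coherence.

Theorem mainTheorem3 (P J : Type) :
  faithful (G P J) /\ preorder_category (LR P J).
Proof. by split=> A B f g; [move=> _|]; exact: arrow_uniq. Qed.
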